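(* Let $\mathcal P$ be a convex polygon in the Euclidean plane with area $K$ and sides $S_1,\dots,S_n$, and let $O$ be an interior point of $\mathcal P$. Let $d_i$ be the perpendicular distance from $O$ to the line containing $S_i$. Let $P$ be uniformly distributed in $\mathcal P$ (with respect to area). Let $X$ be a random point of the boundary $\partial\mathcal P$ with distribution $\mu_O$ given by the density $$d\mu_O(X)=\frac{d_i}{2K}\,ds,\qquad X\in S_i,\ i=1,\dots,n,$$ where $ds$ denotes arclength. Then the random unit vectors $\operatorname{dir}_O(P)$ and $\operatorname{dir}_O(X)$ have the same distribution.
   Context: For a point $Y\neq O$ in the plane, $\operatorname{dir}_O(Y)=\dfrac{Y-O}{|Y-O|}$ is the unit vector pointing from $O$ to $Y$. (The event $P=O$ has probability zero, so $\operatorname{dir}_O(P)$ is defined almost surely.) *)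

(* Defs.v *)
(* MathComp-Analysis, over an arbitrary R : realType; the plane is R * R *)
From HB Require Import structures.
From mathcomp Require Export all_boot all_order all_algebra.
From mathcomp Require Export all_classical all_reals all_analysis.
From mathcomp Require Export measurable_realfun.
Export Order.TTheory GRing.Theory Num.Theory numFieldNormedType.Exports.

Set Implicit Arguments.
Unset Strict Implicit.
Unset Printing Implicit Defensive.

Local Open Scope classical_set_scope.
Local Open Scope ring_scope.

Section plane.
Variable R : realType.
Implicit Types (O Y a b : R * R) (A Pg : set (R * R)).

(* The canonical norm of R * R is the sup norm, so the Euclidean one is
   defined here; the product topology and the product sigma-algebra are the
   usual Euclidean topology and its Borel sigma-algebra. *)
Definition enorm Y : R := Num.sqrt (Y.1 ^+ 2 + Y.2 ^+ 2).

(* [dir O O] is the junk value (0, 0), since 0^-1 = 0. *)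
Definition dir O Y : R * R := (enorm (Y - O))^-1 *: (Y - O).

Definition area : set (R * R) -> \bar R :=
  (@lebesgue_measure R \x @lebesgue_measure R)%E.

Definition segment a b : set (R * R) :=
  [set (1 - t) *: a + t *: b | t in `[0, 1]].

Definition line a b : set (R * R) :=
  [set (1 - t) *: a + t *: b | t in [set: R]].

Definition dist_to O A : R := inf [set enorm (Y - O) | Y in A].

Section polygon.
Variables (n : nat) (v : 'I_n -> R * R).

(* [ordS] is the cyclic successor on 'I_n. *)
Definition side (i : 'I_n) : set (R * R) := segment (v i) (v (ordS i)).

Definition side_line (i : 'I_n) : set (R * R) := line (v i) (v (ordS i)).

(* [Pg] is the closed region bounded by the simple closed polygonal chain
   with vertices [v 0, ..., v (n-1)] (in either orientation), and this region
   is convex.  Consecutive sides are allowed to be collinear. *)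
Record convex_polygon Pg : Prop := ConvexPolygon {
  polygon_ge3 : (3 <= n)%N ;
  polygon_vertices : injective v ;
  polygon_simple : forall i j : 'I_n, i != j ->
    side i `&` side j `<=` [set v i; v (ordS i)] ;
  polygon_compact : compact Pg ;
  polygon_convex : convex_set (Pg : set (convex_lmodType (R * R)%type)) ;
  polygon_boundary : closure Pg `\` Pg° = \bigcup_i side i }.

Definition side_length (i : 'I_n) : R := enorm (v (ordS i) - v i).

Definition side_arc (i : 'I_n) (s : R) : R * R :=
  v i + s *: dir (v i) (v (ordS i)).

(* The arclength integral over [A `&` side i] is written in the unit-speed
   parametrization [side_arc i] of [side i] over [0, side_length i]; the
   vertices, shared by two sides, are negligible. *)
Definition boundary_law O (K : R) A : \bar R :=
  (\sum_(i < n)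
     \int[@lebesgue_measure R]_(s in `[0%R, side_length i] `&` side_arc i @^-1` A)
       (dist_to O (side_line i) / (2 * K))%:E)%E.

End polygon.

Lemma measurable_dir O : measurable_fun [set: R * R] (dir O).
Proof.
have m1 : measurable_fun [set: R * R] (fun Y => Y.1 - O.1).
  exact: measurable_funB.
have m2 : measurable_fun [set: R * R] (fun Y => Y.2 - O.2).
  exact: measurable_funB.
have mV : measurable_fun [set: R * R] (fun Y => (enorm (Y - O))^-1).
  rewrite (_ : (fun _ => _) = (fun x => x `^ (-1)) \o ((fun x => x `^ (2^-1)) \o
    (fun Y : R * R => (Y.1 - O.1) ^+ 2 + (Y.2 - O.2) ^+ 2))).
    apply: measurableT_comp; first exact: measurable_powR.
    apply: measurableT_comp; first exact: measurable_powR.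
    by apply: measurable_funD; apply: measurable_funX.
  apply/funext => Y /=.
  by rewrite powR12_sqrt ?addr_ge0 ?sqr_ge0// powR_inv1 ?sqrtr_ge0.
have -> : dir O = fun Y => ((enorm (Y - O))^-1 * (Y.1 - O.1),
                            (enorm (Y - O))^-1 * (Y.2 - O.2)) by [].
by apply: measurable_fun_pair; apply: measurable_funM.
Qed.

HB.instance Definition _ O :=
  isMeasurableFun.Build _ _ _ _ (dir O) (measurable_dir O).

End plane.

(* Main.v *)
(* Cut the polygon into the triangles with apex O over its sides: they cover it
   because every ray from O leaves it through a boundary point, and by convexity
   that point is unique, so two triangles overlap only on a line through O and a
   vertex, a null set.  In the coordinates (r, r s) of O + r (v_i + s u - O), with
   u the unit direction of S_i, the cone over a measurable set B of arclength
   parameters becomes {(x, y) | 0 < x <= 1, y / x \in B}, of area |B| / 2 by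
   Fubini; the change of coordinates has Jacobian |det (v_i - O, u)| = d_i.  Hence
   the part of the polygon seen from O in the directions A has area
   \sum_i d_i / 2 |{s | dir_O (v_i + s u) \in A}|. *)
Require Import Defs.
From mathcomp Require Import ring lra.

Set Implicit Arguments.
Unset Strict Implicit.
Unset Printing Implicit Defensive.

Local Open Scope classical_set_scope.
Local Open Scope ring_scope.

(** * Lebesgue measure and area under affine maps; area of a sector *)

Section lebesgue_affine.
Variable R : realType.
Local Notation mu := (@lebesgue_measure R).

Lemma measurable_affine (a b : R) : measurable_fun [set: R] (fun x : R => a * x + b).
Proof. by apply: measurable_funD => //; exact: measurable_funM. Qed.

Lemma measurable_preimage d d' (T : measurableType d) (U : measurableType d')
  (f : T -> U) (E : set U) : measurable_fun [set: T] f -> measurable E ->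
  measurable (f @^-1` E).
Proof. by move=> mf mE; rewrite -[X in measurable X]setTI; exact: mf. Qed.

(** Uniqueness of Lebesgue measure: the pushforward scaled by [|a|] has the right value on every
    half-open interval. *)
Lemma lebesgue_measure_affine (a b : R) (E : set R) : a != 0 -> measurable E ->
  mu ((fun x => a * x + b) @^-1` E) = (`|a|^-1%:E * mu E)%E.
Proof.
move=> a0 mE.
pose f : R -> measurableTypeR R := fun x => a * x + b.
have mf : measurable_fun [set: measurableTypeR R] f := measurable_affine a b.
have na0 : 0 < `|a| by rewrite normr_gt0.
have key : mu E = (`|a|%:E * mu (f @^-1` E))%E.
  pose nu : {measure set (measurableTypeR R) -> \bar R} :=
    mscale (NngNum (normr_ge0 a)) (pushforward mu f).
  apply: (@lebesgue_measure_unique R (nu mf)) => // _ [[x y]] _ <-.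
  change (mu `]x, y] = `|a|%:E * mu (f @^-1` `]x, y]))%E.
  have [a_lt0|a_gt0|/eqP] := ltgtP a 0; last by rewrite (negPf a0).
  (* A negative slope reverses the order, so the closed end of the interval moves to the left. *)
  - rewrite (_ : f @^-1` _ = `[(y - b) / a, (x - b) / a[%classic); last first.
      apply/seteqP; split => z /=; rewrite !in_itv/= /f.
        by move=> /andP[h1 h2]; rewrite ler_ndivrMr// ltr_ndivlMr//; lra.
      by rewrite ler_ndivrMr// ltr_ndivlMr// => /andP[h1 h2]; lra.
    rewrite !lebesgue_measure_itv/= !lte_fin ltr_nM2r ?invr_lt0// ltrBlDr subrK.
    case: ifPn => // _; rewrite ?mule0// -!EFinB -EFinM; congr EFin.
    by rewrite ltr0_norm//; field.
  - rewrite (_ : f @^-1` _ = `](x - b) / a, (y - b) / a]%classic); last first.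
      apply/seteqP; split => z /=; rewrite !in_itv/= /f.
        by move=> /andP[h1 h2]; rewrite ltr_pdivrMr// ler_pdivlMr//; lra.
      by rewrite ltr_pdivrMr// ler_pdivlMr// => /andP[h1 h2]; lra.
    rewrite !lebesgue_measure_itv/= !lte_fin ltr_pM2r ?invr_gt0// ltrBlDr subrK.
    case: ifPn => // _; rewrite ?mule0// -!EFinB -EFinM; congr EFin.
    by rewrite gtr0_norm//; field.
rewrite [in RHS]key muleA -EFinM mulVf ?mul1e//.
by rewrite gt_eqF.
Qed.

Local Notation area := (@area R).

Lemma area_ge0 E : (0 <= area E)%E.
Proof. exact: measure_ge0. Qed.

Definition flip (Y : R * R) : R * R := (Y.2, Y.1).

Lemma measurable_flip : measurable_fun [set: R * R] flip.
Proof. exact: measurable_fun_pair. Qed.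

(** The vertical sections of the flipped set are the horizontal sections of [E], so this is
    Tonelli. *)
Lemma area_flip (E : set (R * R)) : measurable E -> area (flip @^-1` E) = area E.
Proof.
move=> mE.
pose m : {sigma_finite_measure set (measurableTypeR R) -> \bar R} := mu.
have FE := @indic_fubini_tonelli_FE _ _ (measurableTypeR R) _ R m E mE.
have GE := @indic_fubini_tonelli_GE _ _ _ (measurableTypeR R) R m E mE.
transitivity (\int[m]_y (m \o ysection E) y)%E; last first.
  by rewrite -GE -(@indic_fubini_tonelli _ _ _ _ R m m E mE) FE.
exact: eq_integral.
Qed.

Lemma measurable_skew (p q r : R) :
  measurable_fun [set: R * R] (fun Y => (Y.1, p * Y.2 + q * Y.1 + r)).
Proof.
apply: measurable_fun_pair => //.
by apply: measurable_funD => //; apply: measurable_funD; apply: measurable_funM.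
Qed.

(** On each vertical section the map is affine with slope [p]; its offset varies with the section
    but does not affect the length. *)
Lemma area_skew (p q r : R) (E : set (R * R)) : p != 0 -> measurable E ->
  area ((fun Y => (Y.1, p * Y.2 + q * Y.1 + r)) @^-1` E) = (`|p|^-1%:E * area E)%E.
Proof.
move=> p0 mE; rewrite /Defs.area /product_measure1.
rewrite -ge0_integralZl//; last first.
  exact: measurable_fun_xsection.
apply: eq_integral => x _ /=.
rewrite -(@lebesgue_measure_affine p (q * x + r))//; last exact: measurable_xsection.
congr (mu _); apply/seteqP; split => y /=; rewrite /xsection /= !inE /=;
 by rewrite addrA.
Qed.

Lemma measurable_affine2 (a b c d e f : R) : measurable_fun [set: R * R]
  (fun Y => (a * Y.1 + b * Y.2 + e, c * Y.1 + d * Y.2 + f)).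
Proof.
by apply: measurable_fun_pair => /=;
  apply: measurable_funD => //; apply: measurable_funD; apply: measurable_funM.
Qed.

Lemma area_affine (a b c d e f : R) (E : set (R * R)) :
  a * d - b * c != 0 -> measurable E ->
  area ((fun Y => (a * Y.1 + b * Y.2 + e, c * Y.1 + d * Y.2 + f)) @^-1` E) =
  (`|a * d - b * c|^-1%:E * area E)%E.
Proof.
move=> D0 mE.
(* For [b != 0] the map is a skew, then a flip, then a skew; precomposing with
   a flip reduces [b = 0] to this. *)
wlog b0 : a b c d E D0 mE / b != 0.
  move=> H; have [b0|/H] := eqVneq b 0; last exact.
  have a0 : a != 0 by apply: contra_neq D0 => ->; rewrite b0; ring.
  rewrite (_ : _ @^-1` E = flip @^-1` ((fun Y : R * R =>
      (b * Y.1 + a * Y.2 + e, d * Y.1 + c * Y.2 + f)) @^-1` E)).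
    rewrite area_flip; last first.
      by apply: measurable_preimage => //; exact: measurable_affine2.
    rewrite H//; last by rewrite -oppr_eq0 opprB.
    by rewrite distrC.
  apply/seteqP; split => -[x y] /=; by rewrite ![_ * y + _]addrC.
have mskew p q r (G : set (R * R)) : measurable G ->
    measurable ((fun Y => (Y.1, p * Y.2 + q * Y.1 + r)) @^-1` G).
  by apply: measurable_preimage; exact: measurable_skew.
have mswap (G : set (R * R)) : measurable G -> measurable (flip @^-1` G).
  by apply: measurable_preimage; exact: measurable_flip.
pose Delta := a * d - b * c.
(* The first skew produces [z = a x + b y + e]; the coefficients of the second come from eliminating
   [y] between this and [c x + d y + f]. *)
rewrite (_ : _ @^-1` E =
  (fun Y => (Y.1, b * Y.2 + a * Y.1 + e)) @^-1` (flip @^-1`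
  ((fun Y => (Y.1, (- Delta / b) * Y.2 + (d / b) * Y.1 + (f - d * e / b))) @^-1` E))); last first.
  have eq2 x y : - Delta / b * x + d / b * (b * y + a * x + e) + (f - d * e / b) =
    c * x + d * y + f by rewrite /Delta; field.
  by apply/seteqP; split => -[x y] /=; rewrite eq2 (addrC (a * x)).
rewrite area_skew; [|exact: b0|by apply: mswap; exact: mskew].
rewrite area_flip; last exact: mskew.
rewrite area_skew; [|by rewrite mulf_neq0 ?oppr_eq0 ?invr_eq0|exact: mE].
rewrite muleA -EFinM; congr (_%:E * _)%E.
by rewrite normrM normrN normfV invfM invrK mulrC mulfK ?normr_eq0.
Qed.

Lemma integral_id01 : (\int[mu]_(x in `]0%R, 1%R]) x%:E = 2^-1%:E)%E.
Proof.
rewrite integral_itv_obnd_cbnd; last exact: measurable_funTS.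
pose F : R -> R := fun x => 2^-1 * x ^+ 2.
have dF (x : R) : is_derive x 1 F x.
  rewrite (_ : F = 2^-1 *: (@id R) ^+ 2); last first.
    by apply/funext => y; rewrite /F /= /GRing.scale /= fctE.
  by apply: is_derive_eq; rewrite /GRing.scale/= expr1 mulr1; field.
have cF (x : R) : {for x, continuous F}.
  by apply/differentiable_continuous/derivable1_diffP; exact: ex_derive.
rewrite (@continuous_FTC2 R id F)//.
- by rewrite -EFinB; congr EFin; rewrite /F expr1n expr0n/= mulr0 mulr1 subr0.
- by apply: continuous_subspaceT => x.
- by split => //; [exact/cvg_at_right_filter/cF|exact/cvg_at_left_filter/cF].
- by move=> x _; rewrite derive1E derive_val.
Qed.

(** The union of the segments from the origin to [(1, s)], for [s] in [B], without the origin. *)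
Definition sector (B : set R) : set (R * R) :=
  [set Y | 0 < Y.1 <= 1 /\ B (Y.1^-1 * Y.2)].

Lemma measurable_sector B : measurable B -> measurable (sector B).
Proof.
move=> mB.
(* The real power is known to be measurable and agrees with the inverse on the positive abscissas of
   the sector. *)
pose f (Y : R * R) := (Y.1 `^ (-1)) * Y.2.
have mf : measurable_fun [set: R * R] f.
  apply: measurable_funM => //.
  apply: (@measurableT_comp _ _ _ _ _ _ (fun x : R => x `^ (-1)) _ fst) => //.
rewrite (_ : sector B = fst @^-1` `]0, 1] `&` f @^-1` B).
  have m1 : measurable (@fst R R @^-1` `]0, 1]).
    by apply: measurable_preimage => //; exact: measurable_itv.
  have m2 : measurable (f @^-1` B) by exact: measurable_preimage.
  exact: measurableI.
apply/seteqP; split => -[x y] /=; rewrite in_itv/= => -[/andP[x0 x1] By]; split;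
  by rewrite ?x0 ?x1//; move: By; rewrite /f /= powR_inv1// ltW.
Qed.

(** The section at [x] in []0, 1]] is [B] scaled by [x], of length [x * mu B], and [x] integrates to
    [1/2]. *)
Lemma area_sector B : measurable B -> area (sector B) = (2^-1%:E * mu B)%E.
Proof.
move=> mB.
transitivity (\int[mu]_(x in `]0%R, 1%R]) (x%:E * mu B))%E; last first.
  rewrite ge0_integralZr//.
  - by rewrite integral_id01.
  - by move=> x /=; rewrite in_itv/= lee_fin => /andP[/ltW].
rewrite [RHS]integral_mkcond; apply: eq_integral => x _.
rewrite patchE/=. case: ifPn => [|]; [rewrite inE|rewrite notin_setE] => x01.
  have x0 : 0 < x by case/andP: x01.
  rewrite (_ : xsection _ x = (fun y => x^-1 * y + 0) @^-1` B); last first.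
    apply/seteqP; split => y; rewrite /xsection /= inE /sector /= addr0.
      by case.
    by [].
  by rewrite lebesgue_measure_affine ?invr_eq0 ?gt_eqF// gtr0_norm ?invr_gt0// invrK.
rewrite (_ : xsection _ x = set0) ?measure0//.
by apply/seteqP; split => y //; rewrite /xsection /= inE => -[].
Qed.
End lebesgue_affine.

(** * Determinants, convexity and rays in the plane *)

Section plane_geometry.
Variable R : realType.
Implicit Types (O Y a b p q : R * R) (Pg : set (R * R)).

Definition det a b : R := a.1 * b.2 - a.2 * b.1.
Definition dot a b : R := a.1 * b.1 + a.2 * b.2.

Lemma dot_gt0 a : a != 0 -> 0 < dot a a.
Proof.
move=> a0; rewrite lt_neqAle eq_sym; apply/andP; split.
  apply: contra a0; rewrite /dot -!expr2 paddr_eq0 ?sqr_ge0// !sqrf_eq0.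
  by case: a => x y /= /andP[/eqP -> /eqP ->].
by rewrite /dot -!expr2 addr_ge0 ?sqr_ge0.
Qed.

Lemma plane_eq a b : a.1 = b.1 -> a.2 = b.2 -> a = b.
Proof. by case: a b => ? ? [? ?] /= -> ->. Qed.

Lemma fst_scale k a : (k *: a).1 = k * a.1. Proof. by []. Qed.
Lemma snd_scale k a : (k *: a).2 = k * a.2. Proof. by []. Qed.
Lemma fst_add a b : (a + b).1 = a.1 + b.1. Proof. by []. Qed.
Lemma snd_add a b : (a + b).2 = a.2 + b.2. Proof. by []. Qed.
Lemma fst_opp a : (- a).1 = - a.1. Proof. by []. Qed.
Lemma snd_opp a : (- a).2 = - a.2. Proof. by []. Qed.

Definition coordE := (fst_scale, snd_scale, fst_add, snd_add, fst_opp, snd_opp).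

Lemma det0_collinear a b : a != 0 -> det a b = 0 -> b = (dot b a / dot a a) *: a.
Proof.
move=> /dot_gt0/lt0r_neq0 N0 D0.
(* The claim is that [b] is its own orthogonal projection onto [a]; after clearing the denominator
   the error is [det a b] times [(- a.2, a.1)]. *)
apply: plane_eq; rewrite coordE; apply: (mulIf N0); rewrite mulrAC divfK//;
  apply/eqP; rewrite -subr_eq0; apply/eqP.
- by transitivity (- a.2 * det a b); [rewrite /det /dot; ring|rewrite D0 mulr0].
- by transitivity (a.1 * det a b); [rewrite /det /dot; ring|rewrite D0 mulr0].
Qed.

Lemma convex_setP Pg k p q : convex_set (Pg : set (convex_lmodType (R * R)%type)) ->
  0 <= k <= 1 -> Pg p -> Pg q -> Pg (k *: p + (1 - k) *: q).
Proof.
move=> cP /andP[k0 k1] Pp Pq.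
have := cP p q (Itv01 k0 k1) (mem_set Pp) (mem_set Pq).
by rewrite inE.
Qed.

Lemma continuous_dotB a b : continuous (fun Y => dot (Y - a) b).
Proof.
move=> Y; apply: cvgD; apply: cvgM; try exact: cvg_cst; apply: cvgB; try exact: cvg_cst.
exact: cvg_fst.
exact: cvg_snd.
Qed.

Lemma continuous_detB a b : continuous (fun Y => det (Y - a) b).
Proof.
move=> Y; apply: cvgB; apply: cvgM; try exact: cvg_cst; apply: cvgB; try exact: cvg_cst.
exact: cvg_fst.
exact: cvg_snd.
Qed.

(** The homothety with centre [q] and ratio [1 - c] maps [Pg] into itself and [O] to the given
    point. Its inverse [g] is continuous, so it pulls a neighbourhood of [O] inside [Pg] back to one
    of that point. *)
Lemma convex_interior Pg O q c : convex_set (Pg : set (convex_lmodType (R * R)%type)) ->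
  Pg° O -> Pg q -> 0 <= c < 1 -> Pg° (O + c *: (q - O)).
Proof.
move=> cP O_in Pq /andP[c0 c1].
have d0 : 1 - c != 0 by rewrite subr_eq0 gt_eqF.
pose g z := (1 - c)^-1 *: (z - c *: q).
have gO : g (O + c *: (q - O)) = O.
  by apply: plane_eq; rewrite /g !coordE; field.
have cg : g z @[z --> O + c *: (q - O)] --> O.
  rewrite -[X in _ --> X]gO; apply: cvgZ; first exact: cvg_cst.
  by apply: cvgB; [exact: cvg_id|exact: cvg_cst].
have := cg _ O_in; rewrite nbhs_simpl /= => H. apply: filterS H => z /= Pgz.
rewrite (_ : z = (1 - c) *: g z + (1 - (1 - c)) *: q); last first.
  by rewrite subKr /g scalerA divff// scale1r subrK.
by apply: convex_setP => //; rewrite subr_ge0 ltW//= gerBl.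
Qed.

(** On the compact intersection of [Pg] with the line through [O] and [Y], take the point [p]
    farthest in the direction [w = Y - O]. Comparison with [Y] itself gives [p - O = t *: w] with
    [1 <= t]. *)
Lemma exit_point Pg O Y : compact Pg -> Pg Y -> Y != O ->
  exists r p, [/\ 0 < r <= 1, (Pg `\` Pg°) p & Y = O + r *: (p - O)].
Proof.
move=> cP PY YO; pose w := Y - O.
have w0 : w != 0 by rewrite subr_eq0.
have N0 := dot_gt0 w0.
pose M := [set Z : R * R | det (Z - O) w = 0].
have clM : closed M.
  have /continuous_closedP cl := @continuous_detB O w.
  exact: (cl [set 0] (@closed_eq R 0)).
have PMY : (Pg `&` M) Y by split => //; rewrite /M /= /det mulrC subrr.
have [||p] := @compact_EVT_max (R * R)%type R
  (fun Z : R * R => dot (Z - O) w) (Pg `&` M) (ex_intro _ Y PMY).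
- exact: compact_closedI.
- exact/continuous_subspaceT/continuous_dotB.
rewrite inE => -[Pp Mp] pmax.
have Mp0 : det (p - O) w = 0 := Mp.
have Dp : det w (p - O) = 0.
  by transitivity (- det (p - O) w); [rewrite /det; ring|rewrite Mp0 oppr0].
have := det0_collinear w0 Dp.
set t := _ / _ => pE.
have t1 : 1 <= t.
  rewrite /t ler_pdivlMr// mul1r; apply: (pmax Y); exact: mem_set.
have t0 : 0 < t by exact: lt_le_trans t1.
exists t^-1, p; split.
- by rewrite invr_gt0 t0 invf_le1.
(* Were [p] interior, a small positive step along [w] would remain in [Pg] and on the line, yet
   increase the maximal dot product. *)
- split => // p_in.
  have : \forall e \near 0^'+, Pg (p + e *: w).
    have cl : p + e *: w @[e --> (0:R)] --> p.
      rewrite -[X in _ --> X]addr0 -(scale0r w).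
      apply: cvgD; first exact: cvg_cst.
      by apply: cvgZ; [exact: cvg_id|exact: cvg_cst].
    exact: (cvg_at_right_filter cl p_in).
  move=> He; have [e [Pe e0]] := @filter_ex R (0:R)^'+ _ _ (filterI He (nbhs_right_gt (0:R))).
  have : dot (p + e *: w - O) w <= dot (p - O) w.
    apply: pmax; apply: mem_set; split => //.
    by transitivity (det (p - O) w); [rewrite /det !coordE; ring|exact: Mp0].
  rewrite leNgt => /negP; apply.
  rewrite -subr_gt0 (_ : _ - _ = e * dot w w); first exact: mulr_gt0.
  by rewrite /dot !coordE; ring.
- by rewrite pE scalerA mulVf ?gt_eqF// scale1r addrC subrK.
Qed.

(* If [p] and [q] differ, the one nearer to [O] is interior. *)
Lemma boundary_ray_inj Pg O p q c :
  convex_set (Pg : set (convex_lmodType (R * R)%type)) -> Pg° O ->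
  (Pg `\` Pg°) p -> (Pg `\` Pg°) q -> 0 < c -> q - O = c *: (p - O) -> p = q.
Proof.
move=> cP OI [Pp pI] [Pq qI] c0 qE.
have [c1|c1|c1] := ltgtP c 1.
- have := convex_interior cP OI Pp (_ : 0 <= c < 1).
  by rewrite -qE addrC subrK c1 ltW// => /(_ isT).
- have := convex_interior cP OI Pq (_ : 0 <= c^-1 < 1).
  rewrite qE scalerA mulVf ?gt_eqF// scale1r addrC subrK invr_ge0 ltW//= invf_lt1//.
  by move=> /(_ c1).
- by move: qE; rewrite c1 scale1r => /addIr.
Qed.

Lemma enormZ k a : enorm (k *: a) = `|k| * enorm a.
Proof.
by rewrite /enorm !coordE !exprMn -mulrDr sqrtrM ?sqr_ge0// sqrtr_sqr.
Qed.

Lemma enorm_eq0 a : (enorm a == 0) = (a == 0).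
Proof.
apply/idP/eqP => [|->]; last by rewrite /enorm /= expr0n addr0 sqrtr0.
apply: contraTeq => /dot_gt0 N0.
by rewrite /enorm gt_eqF// sqrtr_gt0 !expr2.
Qed.

Lemma enorm_gt0 a : (0 < enorm a) = (a != 0).
Proof. by rewrite lt_def enorm_eq0 sqrtr_ge0 andbT. Qed.

Lemma dir_homothety O p r : 0 < r -> dir O (O + r *: (p - O)) = dir O p.
Proof.
move=> r0; rewrite /dir addrAC subrr add0r enormZ scalerA gtr0_norm// invfM.
by rewrite mulrAC mulVf ?gt_eqF// mul1r.
Qed.

Lemma dot_dir p q : p != q -> dot (dir p q) (dir p q) = 1.
Proof.
move=> pq; have e0 : enorm (q - p) != 0 by rewrite enorm_eq0 subr_eq0 eq_sym.
have : enorm (q - p) ^+ 2 = dot (q - p) (q - p).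
  by rewrite sqr_sqrtr ?addr_ge0 ?sqr_ge0// !expr2.
rewrite /dir /dot !(fst_scale, snd_scale) => E.
transitivity ((enorm (q - p))^-1 ^+ 2 * (enorm (q - p)) ^+ 2); last by field.
by rewrite E; ring.
Qed.

(** Pythagoras along the unit vector [u]: the squared distance to a point of the line is a square
    plus the constant [det w u ^+ 2]. *)
Lemma dist_to_line O p q : p != q ->
  dist_to O (line p q) = `|det (p - O) (dir p q)|.
Proof.
move=> pq; set u := dir p q; set w := p - O.
have u1 : dot u u = 1 by exact: dot_dir.
pose L := enorm (q - p).
have L0 : L != 0 by rewrite enorm_eq0 subr_eq0 eq_sym.
have qpE : q - p = L *: u by rewrite /u /dir scalerA divff// scale1r.
have lineE t : (1 - t) *: p + t *: q - O = w + (t * L) *: u.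
  rewrite -scalerA -qpE /w; apply: plane_eq; rewrite !coordE; ring.
have normE s : enorm (w + s *: u) = Num.sqrt ((dot w u + s) ^+ 2 + det w u ^+ 2).
  congr Num.sqrt.
  (* The added last term vanishes since [dot u u = 1]; with it the equality is a polynomial
     identity. *)
  transitivity ((dot w u + s) ^+ 2 + det w u ^+ 2 + (dot w w - s ^+ 2) * (1 - dot u u)).
    by rewrite /dot /det !coordE; ring.
  by rewrite u1 subrr mulr0 addr0.
have lb : lbound [set enorm (Y - O) | Y in line p q] `|det w u|.
  move=> _ [_ [t _ <-] <-]; rewrite lineE normE -sqrtr_sqr.
  by rewrite ler_wsqrtr// lerDr sqr_ge0.
apply/eqP; rewrite eq_le; apply/andP; split; last first.
  apply: lb_le_inf => //; exists (enorm ((1 - 0) *: p + 0 *: q - O)).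
  by exists ((1 - 0) *: p + 0 *: q) => //; exists 0.
apply: ge_inf; first by exists `|det w u|.
(* The foot of the perpendicular, where the displacement [t * L] along [u] cancels [dot w u]. *)
exists ((1 - (- dot w u / L)) *: p + (- dot w u / L) *: q).
  by exists (- dot w u / L).
by rewrite lineE divfK// normE subrr expr0n add0r sqrtr_sqr.
Qed.

End plane_geometry.

(** * Area of the part of a triangle seen from its apex in given directions *)

Section triangle.
Variable R : realType.
Implicit Types (O Y a b p q : R * R) (A Pg : set (R * R)).
Local Notation mu := (@lebesgue_measure R).

(** A rotation composed with a scaling, of determinant [a ^+ 2 + b ^+ 2], carries the line to the
    null vertical line at abscissa [c]. *)
Lemma area_line (a b c : R) : (a, b) != 0 ->
  measurable [set Y : R * R | a * Y.1 + b * Y.2 = c] /\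
  area [set Y : R * R | a * Y.1 + b * Y.2 = c] = 0%E.
Proof.
move=> ab0; have := dot_gt0 ab0; rewrite /dot /= => N0.
have N1 : a * a - b * (- b) != 0 by rewrite mulrN opprK gt_eqF.
pose f (Y : R * R) := (a * Y.1 + b * Y.2 + 0, - b * Y.1 + a * Y.2 + 0).
have mS : measurable ([set c] `*` [set: R] : set (R * R)).
  by apply: measurableX.
have -> : [set Y : R * R | a * Y.1 + b * Y.2 = c] = f @^-1` ([set c] `*` setT).
  by apply/seteqP; split => Y /=; rewrite addr0 // => -[].
split.
  by apply: measurable_preimage => //; exact: measurable_affine2.
rewrite area_affine// /area product_measure1E//.
by rewrite [X in (_ * (X * _))%E](lebesgue_measure_set1 c) mul0e mule0.
Qed.

(** The value [r = 0] is excluded so that each point has the direction of its base point, by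
    [dir_homothety]. *)
Definition cone O A : set (R * R) :=
  [set Y | exists r p, [/\ 0 < r <= 1, A p & Y = O + r *: (p - O)]].

(* The coordinates [(r, r * s)] of [O + r *: (p + s *: dir p q - O)]. *)
Definition frame O p q Y : R * R :=
  (det (Y - O) (dir p q) / det (p - O) (dir p q),
   det (p - O) (Y - O) / det (p - O) (dir p q)).

Arguments frame : simpl never.

Lemma det_dir O p q : det (p - O) (dir p q) = (enorm (q - p))^-1 * det (p - O) (q - O).
Proof. by rewrite /dir /det !coordE; ring. Qed.

Lemma det_dir_neq0 O p q : p != q -> det (p - O) (q - O) != 0 ->
  det (p - O) (dir p q) != 0.
Proof.
by move=> pq D0; rewrite det_dir mulf_neq0// invr_eq0 enorm_eq0 subr_eq0 eq_sym.
Qed.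

Definition arc_params O p q A : set R :=
  `[0, enorm (q - p)] `&` [set s | A (dir O (p + s *: dir p q))].

Lemma measurable_arc_params O p q A : measurable A -> measurable (arc_params O p q A).
Proof.
move=> mA; apply: measurableI; first exact: measurable_itv.
rewrite (_ : [set s | _] = (dir O \o (fun s => p + s *: dir p q)) @^-1` A)//.
apply: measurable_preimage => //.
apply: measurableT_comp; first exact: measurable_dir.
rewrite (_ : (fun s => _) = fun s => (p.1 + s * (dir p q).1, p.2 + s * (dir p q).2))//.
apply: measurable_fun_pair; apply: measurable_funD => //; exact: measurable_funM.
Qed.

Lemma frame_ray O p q r s : det (p - O) (dir p q) != 0 ->
  frame O p q (O + r *: (p + s *: dir p q - O)) = (r, r * s).
Proof.
rewrite /frame; set u := dir p q => D0; congr (_, _); apply: (canLR (mulfK D0));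
  by rewrite /det !coordE; ring.
Qed.

Lemma cramer a b Y : det a b != 0 ->
  Y = (det Y b / det a b) *: a + (det a Y / det a b) *: b.
Proof.
by move=> D0; apply: plane_eq; rewrite !coordE; move: D0; rewrite /det => D0; field.
Qed.

Lemma frame_inv O p q Y : det (p - O) (dir p q) != 0 ->
  Y = O + (frame O p q Y).1 *: (p - O) + (frame O p q Y).2 *: dir p q.
Proof.
by move=> D0; rewrite -addrA -(cramer _ D0) addrC subrK.
Qed.

(** In the coordinates [(x, y)] of [frame], the ray from [O] is determined by the arclength
    parameter [y / x] of its base point, so the condition on the direction only constrains this
    slope. *)
Lemma cone_sector O p q A : p != q -> det (p - O) (q - O) != 0 ->
  cone O (segment p q) `&` dir O @^-1` A =
  frame O p q @^-1` sector (arc_params O p q A).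
Proof.
move=> pq D0; have D1 := det_dir_neq0 pq D0.
have e0 : 0 < enorm (q - p) by rewrite enorm_gt0 subr_eq0 eq_sym.
have regroup (u : R * R) (x y : R) : x != 0 ->
    O + x *: (p - O) + y *: u = O + x *: (p + (x^-1 * y) *: u - O).
  by move=> x0; apply: plane_eq; rewrite !coordE; field.
apply/seteqP; split => Y.
  move=> [[r [_ [r01 [t + <-] YE]]]]; rewrite /= in_itv/= => /andP[t0 t1].
  have r0 : 0 < r by case/andP: r01.
  (* The barycentric parameter [t] corresponds to the arclength [t * enorm (q - p)]. *)
  have ptE : (1 - t) *: p + t *: q = p + (t * enorm (q - p)) *: dir p q.
    by rewrite /dir scalerA mulfK ?gt_eqF//; apply: plane_eq; rewrite !coordE; ring.
  rewrite YE ptE dir_homothety// => AY.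
  rewrite [frame _ _ _ _](frame_ray r (t * enorm (q - p)) D1) /sector /=; split => //.
  rewrite mulKf ?gt_eqF//; split => //=.
  by rewrite in_itv/= mulr_ge0 ?(ltW e0)//= ler_piMl// ltW.
rewrite /sector /=; set x := (frame O p q Y).1; set y := (frame O p q Y).2.
move=> [x01 []]; rewrite /= in_itv/= => /andP[s0 sL] Ad.
have x0 : 0 < x by case/andP: x01.
have YE : Y = O + x *: (p + (x^-1 * y) *: dir p q - O).
  by rewrite [LHS](frame_inv Y D1) -/x -/y regroup// gt_eqF.
split; last by rewrite YE dir_homothety.
exists x, (p + (x^-1 * y) *: dir p q); split => //.
exists (x^-1 * y / enorm (q - p)).
  by rewrite /= in_itv/= divr_ge0 ?(ltW e0)//= ler_pdivrMr// mul1r.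
rewrite /dir scalerA; apply: plane_eq; rewrite !coordE; ring.
Qed.

(** The affine map [frame] has determinant [D^-1], so its preimages have [|D|] times the area; the
    sector contributes the factor [1/2]. *)
Lemma area_cone O p q A : p != q -> det (p - O) (q - O) != 0 -> measurable A ->
  measurable (cone O (segment p q) `&` dir O @^-1` A) /\
  area (cone O (segment p q) `&` dir O @^-1` A) =
  ((`|det (p - O) (dir p q)| / 2)%:E * mu (arc_params O p q A))%E.
Proof.
move=> pq D0 mA; have D1 := det_dir_neq0 pq D0; rewrite cone_sector//.
have mB := measurable_arc_params O p q mA.
set u := dir p q in D1 *; set w := p - O in D1 *; set D := det w u in D1 *.
pose f (Y : R * R) := (u.2 / D * Y.1 + - u.1 / D * Y.2 + - det O u / D,
   - w.2 / D * Y.1 + w.1 / D * Y.2 + - det w O / D).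
have -> : frame O p q = f.
  by apply/funext => Y; rewrite /frame /f -/u -/w -/D; congr (_, _); rewrite /det !coordE; ring.
have DE : u.2 / D * (w.1 / D) - - u.1 / D * (- w.2 / D) = D^-1.
  transitivity (det w u / D / D); first by rewrite /det; ring.
  by rewrite divff// mul1r.
split.
  by apply: measurable_preimage; [exact: measurable_affine2|exact: measurable_sector].
rewrite area_affine ?DE ?invr_eq0//; last exact: measurable_sector.
by rewrite area_sector// muleA -EFinM normfV invrK.
Qed.

End triangle.

(** * Cyclic indices, finite unions and removal of null sets *)

Lemma ordS_neq n (i : 'I_n) : (1 < n)%N -> ordS i != i.
Proof.
move=> n1; apply/eqP => /(congr1 val) /=.
case: (ltngtP i.+1 n) (ltn_ord i) => // [lt _|eqn _].
  by rewrite modn_small// => /eqP; rewrite gtn_eqF.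
by rewrite eqn modnn => i0; move: n1; rewrite -eqn -i0.
Qed.

Lemma bigsetU_ordP T n (F : 'I_n -> set T) x :
  (\big[setU/set0]_(i < n) F i) x <-> exists i, F i x.
Proof.
split=> [|[i Fix]]; last by rewrite (bigD1 i)//=; left.
by elim/big_ind: _ => [//|A B IA IB [/IA|/IB]//|i _ Fix]; exists i.
Qed.

Section area.
Variable R : realType.
Implicit Types A B : set (R * R).

Lemma areaU A B : measurable A -> measurable B ->
  (area (A `|` B) <= area A + area B)%E.
Proof. by move=> mA mB; exact: measureU2. Qed.

Lemma area_setD_null A N : measurable A -> measurable N -> area N = 0%E ->
  area (A `\` N) = area A.
Proof.
move=> mA mN N0; apply/eqP; rewrite eq_le; apply/andP; split.
  by apply: le_measure; rewrite ?inE//; exact: measurableD.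
rewrite -[leRHS]adde0 -N0.
apply: le_trans (areaU (measurableD mA mN) mN).
apply: le_measure; rewrite ?inE//.
  by apply: measurableU => //; exact: measurableD.
by move=> x Ax; have [Nx|Nx] := pselect (N x); [right|left].
Qed.
End area.

(** * Decomposition of the polygon into triangles with apex [O] *)

Section convex_polygon.
Variables (R : realType) (n : nat) (v : 'I_n -> R * R) (Pg : set (R * R)) (O : R * R).
Hypotheses (polygonPg : convex_polygon v Pg) (O_in : Pg° O).
Local Notation mu := (@lebesgue_measure R).

Let cvx := polygon_convex polygonPg.

Lemma polygon_sides : Pg `\` Pg° = \bigcup_i side v i.
Proof.
rewrite -(polygon_boundary polygonPg); congr (_ `\` _); apply: (iffLR (closure_id _)).
exact: compact_closed (polygon_compact polygonPg).
Qed.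

Lemma side_boundary i p : side v i p -> (Pg `\` Pg°) p.
Proof. by move=> ip; rewrite polygon_sides; exists i. Qed.

Lemma vertex_side i : side v i (v i).
Proof. by exists 0; [rewrite /= in_itv/= lexx ler01|rewrite subr0 scale1r scale0r addr0]. Qed.

Lemma vertex_sideS i : side v i (v (ordS i)).
Proof. by exists 1; [rewrite /= in_itv/= lexx ler01|rewrite subrr scale1r scale0r add0r]. Qed.

Lemma vertex_neq i : v i != v (ordS i).
Proof.
apply/eqP => /(polygon_vertices polygonPg) /eqP; rewrite eq_sym; apply/negP/ordS_neq.
exact: ltn_trans (polygon_ge3 polygonPg).
Qed.

Lemma side_neq_center i p : side v i p -> p != O.
Proof. by move=> /side_boundary[_ pI]; apply: contra_notN pI => /eqP ->. Qed.

(** Suppose [O] were collinear with the ends of the side. If it separates them it lies on the side,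
    hence on the boundary; otherwise both ends are boundary points on one ray and coincide. *)
Lemma side_det_neq0 i : det (v i - O) (v (ordS i) - O) != 0.
Proof.
have p0 : v i - O != 0 by rewrite subr_eq0 (side_neq_center (vertex_side i)).
have q0 : v (ordS i) - O != 0 by rewrite subr_eq0 (side_neq_center (vertex_sideS i)).
apply/eqP => /(det0_collinear p0); set c := _ / _ => qE.
have [c0|c0|c0] := ltgtP c 0; last by move: q0; rewrite qE c0 scale0r eqxx.
- have : side v i O.
    have c1 : 0 < 1 - c by rewrite subr_gt0 (lt_trans c0).
    (* The solution [t] of [(1 - t) + t * c = 0]. *)
    exists (1 - c)^-1.
      rewrite /= in_itv/= invr_ge0 (ltW c1)/= invf_le1// lerBrDr.
      by rewrite gerDl ltW.
    rewrite -[v (ordS i)](subrK O) qE.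
    apply: plane_eq; rewrite !coordE; field; exact: lt0r_neq0.
  by move=> /side_neq_center; rewrite eqxx.
- have := boundary_ray_inj cvx O_in (side_boundary (vertex_side i))
    (side_boundary (vertex_sideS i)) c0 qE.
  by apply/eqP; exact: vertex_neq.
Qed.

Lemma polygon_cones : Pg = [set O] `|` \bigcup_i cone O (side v i).
Proof.
apply/seteqP; split => Y.
  move=> PY; have [->|YO] := eqVneq Y O; [by left|right].
  have [r [p [r01 bp YE]]] := exit_point (polygon_compact polygonPg) PY YO.
  by move: bp; rewrite polygon_sides => -[i _ ip]; exists i => //; exists r, p.
move=> [->|[i _ [r [p [/andP[r0 r1] /side_boundary[Pp _] ->]]]]].
  exact: interior_subset.
have -> : O + r *: (p - O) = r *: p + (1 - r) *: O.
  by apply: plane_eq; rewrite !coordE; ring.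
by apply: convex_setP => //; [rewrite ltW|exact: interior_subset].
Qed.

(** A null set containing [O] and all overlaps of cones over distinct sides. *)
Definition vertex_lines : set (R * R) :=
  \big[setU/set0]_(i < n) [set Y | det (v i - O) (Y - O) = 0].

Lemma vertex_lines_null : measurable vertex_lines /\ area vertex_lines = 0%E.
Proof.
have lineE i : measurable [set Y | det (v i - O) (Y - O) = 0] /\
    area [set Y | det (v i - O) (Y - O) = 0] = 0%E.
  rewrite (_ : mkset _ = [set Y : R * R | (- (v i - O).2) * Y.1 + (v i - O).1 * Y.2 =
      det (v i - O) O]).
    apply: area_line; apply: contra (side_neq_center (vertex_side i)).
    rewrite xpair_eqE oppr_eq0 !coordE !subr_eq0 => /andP[/eqP e2 /eqP e1].
    by apply/eqP/plane_eq.
  have E (Y : R * R) : det (v i - O) (Y - O) =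
      - (v i - O).2 * Y.1 + (v i - O).1 * Y.2 - det (v i - O) O.
    by rewrite /det !coordE; ring.
  by apply/seteqP; split => Y /=; rewrite E => /eqP H; apply/eqP; move: H; rewrite subr_eq0.
rewrite /vertex_lines; elim/big_ind: _ => [|A B|//].
  by split; [exact: measurable0|rewrite /area measure0].
move=> [mA A0] [mB B0]; split; first exact: measurableU.
apply/eqP; rewrite eq_le area_ge0 andbT.
by rewrite (le_trans (areaU mA mB))// A0 B0 adde0.
Qed.

(** The two base points lie on one ray, hence are equal; a point shared by two sides is a vertex by
    [polygon_simple]. *)
Lemma cone_overlap i j Y : i != j -> cone O (side v i) Y -> cone O (side v j) Y ->
  vertex_lines Y.
Proof.
move=> ij [r [p [/andP[r0 _] ip YE]]] [s [q [/andP[s0 _] jq YE']]].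
have pq : p = q.
  apply: (boundary_ray_inj cvx O_in (side_boundary ip) (side_boundary jq) (c := r / s)).
    exact: divr_gt0.
  apply: (scalerI (lt0r_neq0 s0)); rewrite scalerA mulrCA divff ?gt_eqF// mulr1.
  by apply: (addrI O); rewrite -YE -YE'.
have vl k : Y = O + r *: (v k - O) -> vertex_lines Y.
  move=> ->; apply/bigsetU_ordP; exists k => /=.
  by rewrite /det !coordE; ring.
by have [pE|pE] := polygon_simple polygonPg ij (conj ip (eq_ind_r _ jq pq));
  apply: vl; rewrite YE pE.
Qed.

Lemma area_polygon_cone A : measurable A ->
  area (dir O @^-1` A `&` Pg) =
  (\sum_(i < n) (dist_to O (side_line v i) / 2)%:E *
     mu (arc_params O (v i) (v (ordS i)) A))%E.
Proof.
move=> mA.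
pose F i := cone O (side v i) `&` dir O @^-1` A.
have mF i : measurable (F i) by have [] := area_cone (vertex_neq i) (side_det_neq0 i) mA.
have [mN N0] := vertex_lines_null.
(* [O] lies on each vertex line; the existence of one vertex puts it in [vertex_lines]. *)
pose i0 : 'I_n := Ordinal (ltn_trans (ltn0Sn 1) (polygon_ge3 polygonPg)).
(* Removing the null vertex lines discards the apex and makes the cones disjoint, so that areas add
   up. *)
transitivity (area (\big[setU/set0]_(i < n) (F i `\` vertex_lines))).
  have CPE : dir O @^-1` A `&` Pg =
      (dir O @^-1` A `&` [set O]) `|` \big[setU/set0]_(i < n) F i.
    rewrite polygon_cones setIUr setI_bigcupr; congr (_ `|` _).
    apply/seteqP; split => Y.
      by move=> [i _ [AY iY]]; apply/bigsetU_ordP; exists i.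
    by move=> /bigsetU_ordP[i [iY AY]]; exists i.
  rewrite CPE -(area_setD_null _ mN N0); last first.
    apply: measurableU; last exact: bigsetU_measurable.
    apply: measurableI; first by apply: measurable_preimage => //; exact: measurable_dir.
    rewrite (_ : [set O] = [set O.1] `*` [set O.2]); first exact: measurableX.
    by apply/seteqP; split => [_ ->//|Y /= [e1 e2]]; exact: plane_eq.
  congr area; apply/seteqP; split => Y.
    move=> [[[_ ->]|/bigsetU_ordP[i Fi]] nY]; last by apply/bigsetU_ordP; exists i.
    case: nY; apply/bigsetU_ordP; exists i0 => /=.
    by rewrite /det !coordE; ring.
  move=> /bigsetU_ordP[i [Fi nY]]; split => //; right.
  by apply/bigsetU_ordP; exists i.
rewrite /area measure_bigsetU_ord.
- apply: eq_bigr => i _; rewrite [LHS](area_setD_null (mF i) mN N0).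
  rewrite (proj2 (area_cone (vertex_neq i) (side_det_neq0 i) mA)).
  by rewrite dist_to_line// vertex_neq.
- by move=> i; exact: (measurableD (mF i) mN).
- apply/trivIsetP => i j _ _ ij; apply/seteqP; split => // Y [[[Yi _] Yn] [[Yj _] _]].
  exact: Yn (cone_overlap ij Yi Yj).
Qed.

End convex_polygon.

(** * Comparison of the two laws of directions, side by side *)

Theorem theorem2p1 (R : realType)
  (n : nat) (v : 'I_n -> R * R) (Pg : set (R * R)) (K : R) (O : R * R)
  (polygonPg : convex_polygon v Pg)
  (areaPg : area Pg = K%:E)
  (O_in : Pg° O)
  (d1 : measure_display) (T1 : measurableType d1) (Pr1 : probability T1 R)
  (P : {RV Pr1 >-> (R * R)%type})
  (P_uniform : forall A : set (R * R), measurable A ->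
    distribution Pr1 P A = (K^-1%:E * area (A `&` Pg))%E)
  (d2 : measure_display) (T2 : measurableType d2) (Pr2 : probability T2 R)
  (X : {RV Pr2 >-> (R * R)%type})
  (X_mu : forall A : set (R * R), measurable A ->
    distribution Pr2 X A = boundary_law v O K A) :
  forall A : set (R * R), measurable A ->
    distribution Pr1 (dir O \o P) A = distribution Pr2 (dir O \o X) A.
Proof.
move=> A mA.
have mC : measurable (dir O @^-1` A).
  by apply: measurable_preimage => //; exact: measurable_dir.
transitivity (distribution Pr1 P (dir O @^-1` A)) => //.
transitivity (distribution Pr2 X (dir O @^-1` A)) => //.
rewrite P_uniform// X_mu// (area_polygon_cone polygonPg O_in mA) /boundary_law.
rewrite ge0_sume_distrr; last first.
  move=> i _; apply: mule_ge0 => //; rewrite lee_fin divr_ge0//.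
  by rewrite dist_to_line ?(vertex_neq polygonPg)//.
apply: eq_bigr => i _.
have mB := measurable_arc_params O (v i) (v (ordS i)) mA.
(* The density is constant on a side, so both terms are multiples of the length of [arc_params]; the
   factors [K^-1 * (d_i / 2)] and [d_i / (2 * K)] agree. *)
rewrite muleA -EFinM integral_cst//; congr (_%:E * _)%E.
by rewrite invfM [RHS]mulrA [RHS]mulrC.
Qed.
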